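(* Let $G$ and $\mu$ be as in the context, and let $\phi(x)$ be a formula such that $\phi^\ell(x;y):=\phi(y\cdot x)$ is NIP. Suppose $\nu$ is a left invariant finitely additive probability measure defined on some Boolean algebra $\mathcal{B}$ of subsets of $G$ containing all left translates $g\phi(G)$, $g\in G$, of $\phi(G)$ (left invariant meaning $\nu(gX)=\nu(X)$ whenever $X,gX\in\mathcal{B}$). Then $\nu(\phi(x))=\mu(\phi(x))$.
   Context: Let $\mathcal{L}$ be a first-order language expanding the language of groups. Expand $\mathcal{L}$ to $\mathcal{L}^+$ by a new sort $\mathcal{I}$ with a binary relation $<$, a binary function $d$, and, for each $\mathcal{L}$-formula $\phi(\bar x;\bar y)$, a function symbol $\mu_\phi(\bar y)$ into $\mathcal{I}$; each finite $\mathcal{L}$-structure $A$ becomes an $\mathcal{L}^+$-structure by interpreting $\mathcal{I}$ as $[0,1]$ with its order and $d(s,t)=|s-t|$, and $\mu_\phi(\bar b)$ as $|\phi(A^{\bar x},\bar b)|/|A|^{|\bar x|}$. $G$ is a sufficiently saturated elementary extension of an ultraproduct of finite groups (expanded to $\mathcal{L}^+$-structures in this way). ''Formula'' means $\mathcal{L}$-formula with parameters from $G$. The pseudofinite counting measure is $\mu(\phi(\bar x,\bar b))=$ standard part of $\mu_\phi(\bar b)$. A formula $\psi(\bar x;\bar y)$ is NIP if for some $k$ there are no $(\bar a_i)_{i\in[k]}$, $(\bar b_X)_{X\subseteq[k]}$ with $G\models\psi(\bar a_i,\bar b_X)\iff i\in X$. *)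

(* Defs.v *)
From mathcomp Require Import all_boot.
From Stdlib Require Import Reals Lra ClassicalEpsilon.
Set Implicit Arguments. Unset Strict Implicit. Unset Printing Implicit Defensive.

Record lang := Lang {
  fsym : Type; farity : fsym -> nat;
  rsym : Type; rarity : rsym -> nat;
  gmul : fsym; ginv : fsym; gone : fsym;
  gmul_ar : farity gmul = 2; ginv_ar : farity ginv = 1; gone_ar : farity gone = 0 }.

(* L-terms and L-formulas (de Bruijn variables: var 0 is bound by fex). *)
Inductive term (L : lang) : Type :=
  | tvar : nat -> term L
  | tapp (f : fsym L) : ('I_(farity f) -> term L) -> term L.

Inductive form (L : lang) : Type :=
  | feq : term L -> term L -> form L
  | frel (r : rsym L) : ('I_(rarity r) -> term L) -> form L
  | fneg : form L -> form L
  | fand : form L -> form L -> form L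
  | fex : form L -> form L.

(* L^+ : a second sort I with <, d and a function symbol mu_(n,m,phi) :
   home^m -> I for every L-formula phi(x_1..x_n ; y_1..y_m)
   (x = variables 0..n-1, y = variables n..n+m-1). *)
Inductive iterm (L : lang) : Type :=
  | ivar : nat -> iterm L
  | idst : iterm L -> iterm L -> iterm L
  | imu : nat -> forall m : nat, form L -> ('I_m -> term L) -> iterm L.

Inductive pform (L : lang) : Type :=
  | peq : term L -> term L -> pform L
  | prel (r : rsym L) : ('I_(rarity r) -> term L) -> pform L
  | pIeq : iterm L -> iterm L -> pform L
  | plt : iterm L -> iterm L -> pform L
  | pneg : pform L -> pform L
  | pand : pform L -> pform L -> pform L
  | pexH : pform L -> pform L
  | pexI : pform L -> pform L.

Record lstruc (L : lang) (M : Type) := LStruc {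
  fint : forall f : fsym L, ('I_(farity f) -> M) -> M;
  rint : forall r : rsym L, ('I_(rarity r) -> M) -> Prop }.
Arguments fint {L M} l f _.
Arguments rint {L M} l r _.

Definition ord0_elim (T : Type) (i : 'I_0) : T :=
  False_rect T (Bool.diff_false_true (ltn_ord i : false = true)).

Definition s_mul L M (S : lstruc L M) (a b : M) : M :=
  fint S (gmul L) (fun i => if nat_of_ord i == 0 then a else b).
Definition s_inv L M (S : lstruc L M) (a : M) : M :=
  fint S (ginv L) (fun _ => a).
Definition s_one L M (S : lstruc L M) : M :=
  fint S (gone L) (fun i => ord0_elim M (cast_ord (gone_ar L) i)).

Definition is_group L M (S : lstruc L M) : Prop :=
  (forall a b c, s_mul S (s_mul S a b) c = s_mul S a (s_mul S b c)) /\
  (forall a, s_mul S (s_one S) a = a) /\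
  (forall a, s_mul S (s_inv S a) a = s_one S).

Definition scons T (a : T) (e : nat -> T) : nat -> T :=
  fun i => match i with 0 => a | S i' => e i' end.

Fixpoint teval L M (S : lstruc L M) (e : nat -> M) (t : term L) {struct t} : M :=
  match t with
  | tvar i => e i
  | tapp f ts => fint S f (fun k => teval S e (ts k))
  end.

Fixpoint sat L M (S : lstruc L M) (e : nat -> M) (p : form L) {struct p} : Prop :=
  match p with
  | feq t u => teval S e t = teval S e u
  | frel r ts => rint S r (fun k => teval S e (ts k))
  | fneg q => ~ sat S e q
  | fand q1 q2 => sat S e q1 /\ sat S e q2
  | fex q => exists a : M, sat S (scons a e) q
  end.

Record pstruc (L : lang) (M I : Type) := PStruc {
  hstr : lstruc L M;
  ilt : I -> I -> Prop;
  idist : I -> I -> I;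
  imuI : nat -> forall m : nat, form L -> ('I_m -> M) -> I }.

Fixpoint ieval L M I (P : pstruc L M I) (eH : nat -> M) (eI : nat -> I)
  (s : iterm L) {struct s} : I :=
  match s with
  | ivar i => eI i
  | idst s1 s2 => idist P (ieval P eH eI s1) (ieval P eH eI s2)
  | imu n m q ts => imuI P n q (fun k => teval (hstr P) eH (ts k))
  end.

Fixpoint psat L M I (P : pstruc L M I) (eH : nat -> M) (eI : nat -> I)
  (p : pform L) {struct p} : Prop :=
  match p with
  | peq t u => teval (hstr P) eH t = teval (hstr P) eH u
  | prel r ts => rint (hstr P) r (fun k => teval (hstr P) eH (ts k))
  | pIeq s1 s2 => ieval P eH eI s1 = ieval P eH eI s2
  | plt s1 s2 => ilt P (ieval P eH eI s1) (ieval P eH eI s2)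
  | pneg q => ~ psat P eH eI q
  | pand q1 q2 => psat P eH eI q1 /\ psat P eH eI q2
  | pexH q => exists a : M, psat P (scons a eH) eI q
  | pexI q => exists a : I, psat P eH (scons a eI) q
  end.

(* Environment for phi(x_1..x_n ; y_1..y_m): variable i < n is x_i,
   variable n + j (j < m) is y_j, every other variable gets default d
   (the group identity). *)
Definition mkenv M (d : M) (n m : nat) (xs : 'I_n -> M) (ys : 'I_m -> M)
  : nat -> M :=
  fun i => match (insub i : option 'I_n) with
           | Some k => xs k
           | None => match (insub (i - n) : option 'I_m) with
                     | Some k => ys k
                     | None => d
                     end
           end.

Definition unitI := {r : R | (0 <= r <= 1)%R}.
Definition clamp (r : R) : R := Rmax 0 (Rmin 1 r).
Lemma clamp_in (r : R) : (0 <= clamp r <= 1)%R.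
Proof.
unfold clamp; split; [apply Rmax_l | apply Rmax_lub; [lra | apply Rmin_l]].
Qed.
(* [mkI r] is r whenever r already lies in [0,1] (always the case below). *)
Definition mkI (r : R) : unitI := exist _ (clamp r) (clamp_in r).
Definition zeroI : unitI := mkI 0.

Definition asb (P : Prop) : bool :=
  if excluded_middle_informative P then true else false.

Definition count_sol L (A : finType) (S : lstruc L A) (n m : nat) (q : form L)
  (ys : 'I_m -> A) : nat :=
  #|[set f : {ffun 'I_n -> A} | asb (sat S (mkenv (s_one S) f ys) q)]|.

Definition finexp L (A : finType) (S : lstruc L A) : pstruc L A unitI :=
  PStruc S
    (fun s t => (proj1_sig s < proj1_sig t)%R)
    (fun s t => mkI (Rabs (proj1_sig s - proj1_sig t)))
    (fun n m q ys => mkI (INR (count_sol S n q ys) / INR (#|A| ^ n)%N)).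

Definition ultrafilter (J : Type) (U : (J -> Prop) -> Prop) : Prop :=
  U (fun _ => True) /\ ~ U (fun _ => False) /\
  (forall X Y, U X -> (forall j, X j -> Y j) -> U Y) /\
  (forall X Y, U X -> U Y -> U (fun j => X j /\ Y j)) /\
  (forall X, U X \/ U (fun j => ~ X j)).

Section Ultraproduct.
Variables (J : Type) (U : (J -> Prop) -> Prop) (T : J -> Type).
Definition eqU (a b : forall j, T j) : Prop := U (fun j => a j = b j).
Definition uprod := {C : (forall j, T j) -> Prop | exists a, C = eqU a}.
Definition ucls (a : forall j, T j) : uprod := exist _ (eqU a) (ex_intro _ a erefl).
Definition urep (x : uprod) : forall j, T j :=
  proj1_sig (constructive_indefinite_description _ (proj2_sig x)).
End Ultraproduct.

Section UltraStruct.
Variables (L : lang) (J : Type) (U : (J -> Prop) -> Prop)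
  (A : J -> finType) (SA : forall j, lstruc L (A j)).
Definition UH := uprod U (fun j => A j).
Definition UI := uprod U (fun _ : J => unitI).

Definition ustruc : lstruc L UH :=
  LStruc (fun f args => ucls U (fun j => fint (SA j) f (fun k => urep (args k) j)))
         (fun r args => U (fun j => rint (SA j) r (fun k => urep (args k) j))).

Definition upstruc : pstruc L UH UI :=
  PStruc ustruc
    (fun s t => U (fun j => ilt (finexp (SA j)) (urep s j) (urep t j)))
    (fun s t => ucls U (fun j => idist (finexp (SA j)) (urep s j) (urep t j)))
    (fun n m q ys => ucls U (fun j => imuI (finexp (SA j)) n q
                                        (fun k => urep (ys k) j))).
End UltraStruct.

Definition elem_emb L M1 I1 M2 I2 (P1 : pstruc L M1 I1) (P2 : pstruc L M2 I2)
  (hH : M1 -> M2) (hI : I1 -> I2) : Prop :=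
  forall (p : pform L) eH eI,
    psat P1 eH eI p <-> psat P2 (fun i => hH (eH i)) (fun i => hI (eI i)) p.

(* aleph_1-saturation: every finitely satisfiable set of L^+-formulas in
   one free variable (home variable 0, resp. I-variable 0) with countably
   many parameters (the remaining variables, interpreted by p, q) is
   realized. *)
Definition aleph1_saturated L M I (P : pstruc L M I) : Prop :=
  (forall (p : nat -> M) (q : nat -> I) (Sig : pform L -> Prop),
     (forall l : list (pform L), (forall s, List.In s l -> Sig s) ->
        exists a : M, forall s, List.In s l -> psat P (scons a p) q s) ->
     exists a : M, forall s, Sig s -> psat P (scons a p) q s) /\
  (forall (p : nat -> M) (q : nat -> I) (Sig : pform L -> Prop),
     (forall l : list (pform L), (forall s, List.In s l -> Sig s) ->
        exists a : I, forall s, List.In s l -> psat P p (scons a q) s) ->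
     exists a : I, forall s, Sig s -> psat P p (scons a q) s).

Definition is_stdpart L M I (P : pstruc L M I) (emb : unitI -> I) (t : I)
  (r : unitI) : Prop :=
  forall eps : unitI, (0 < proj1_sig eps)%R ->
    ilt P (idist P t (emb r)) (emb eps).
Definition stdpart L M I (P : pstruc L M I) (emb : unitI -> I) (t : I) : R :=
  proj1_sig (epsilon (inhabits zeroI) (is_stdpart P emb t)).

Definition NIP M (psi : M -> M -> Prop) : Prop :=
  exists k : nat, ~ exists (a : 'I_k -> M) (b : {set 'I_k} -> M),
    forall (i : 'I_k) (X : {set 'I_k}), psi (a i) (b X) <-> i \in X.

Definition boolean_algebra M (B : (M -> Prop) -> Prop) : Prop :=
  B (fun _ => True) /\
  (forall X, B X -> B (fun a => ~ X a)) /\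
  (forall X Y, B X -> B Y -> B (fun a => X a \/ Y a)).

Definition fin_add_prob M (B : (M -> Prop) -> Prop) (nu : (M -> Prop) -> R) : Prop :=
  nu (fun _ => True) = 1%R /\
  (forall X, B X -> (0 <= nu X)%R) /\
  (forall X Y, B X -> B Y -> (forall a, X a -> Y a -> False) ->
     nu (fun a => X a \/ Y a) = (nu X + nu Y)%R).

Definition ltrans L M (S : lstruc L M) (g : M) (X : M -> Prop) : M -> Prop :=
  fun a => exists x, X x /\ a = s_mul S g x.

Definition left_invariant L M (S : lstruc L M) (B : (M -> Prop) -> Prop)
  (nu : (M -> Prop) -> R) : Prop :=
  forall g X, B X -> B (ltrans S g X) -> nu (ltrans S g X) = nu X.

(* Main.v *)
Require Import Defs.
From mathcomp Require Import all_boot.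
From mathcomp Require all_order all_algebra zify ring lra.
From Stdlib Require Import Reals Lra Classical ClassicalEpsilon.
From Stdlib Require Import FunctionalExtensionality PropExtensionality.
Set Implicit Arguments. Unset Strict Implicit. Unset Printing Implicit Defensive.

(** Fix [eps > 0].  In a finite group [A], sample points [y] uniformly and count
    the hits [phi (y * x)]: for each [x] the expected frequency is the density
    [mu] of [phi], because right translation preserves the counting measure.
    Since [phi (y * x)] is NIP, the Vapnik-Chervonenkis uniform law of large
    numbers gives [g_1 .. g_n], with [n] depending only on [eps] and the NIP
    bound, such that for all [x] the frequency of [phi (g_i * x)] is within
    [eps] of [mu].  For fixed [n] this is a first-order statement, so it passes
    to [G].  There it says that the average of the indicators of the translates
    [g_i^-1 phi(G)] is everywhere within [eps] of [mu]; integrating it against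
    [nu] shows that [nu phi(G)] is a standard part of [mu_phi].  The uniform law
    is proved by symmetrization: the two samples are swapped by random signs,
    the Sauer-Shelah lemma bounds the number of traces, and each trace deviates
    for exponentially few sign vectors. *)

(* A module, because ring_scope and R_scope share the delimiting key R. *)
Module UniformLaw.
Import all_boot all_order all_algebra zify ring lra.
Import Order.TTheory GRing.Theory Num.Theory.

(** * Shattering and the Sauer-Shelah lemma *)

Definition shattered (V : finType) (F : {set {set V}}) (X : {set V}) : bool :=
  [forall Y : {set V}, (Y \subset X) ==> [exists S in F, X :&: S == Y]].

Lemma shatteredP (V : finType) (F : {set {set V}}) (X : {set V}) :
  reflect (forall Y : {set V}, Y \subset X -> exists2 S, S \in F & X :&: S = Y)
          (shattered F X).
Proof.
apply: (iffP forallP) => [H Y sYX | H Y].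
  by have /implyP/(_ sYX)/exists_inP[S SF /eqP] := H Y; exists S.
by apply/implyP => /H[S SF <-]; apply/exists_inP; exists S.
Qed.

Lemma shatteredS (V : finType) (F F' : {set {set V}}) (X : {set V}) :
  F \subset F' -> shattered F X -> shattered F' X.
Proof.
move=> /subsetP sFF' /shatteredP H; apply/shatteredP => Y /H[S SF <-].
by exists S => //; apply: sFF'.
Qed.

(** Induction on the size of the family, halved according to membership of a point [x] on which two
    members differ. Sets shattered by either half are shattered by [F]. A set [X] shattered by both
    halves is counted twice, and its second copy is paid for by [x |: X], which [F] also
    shatters. *)
Lemma pajor (V : finType) (F : {set {set V}}) :
  #|F| <= #|[set X | shattered F X]|.
Proof.
have [N] := ubnP #|F|; elim: N F => // N IHN F /ltnSE leFN.
have [/cards1P[S ->]|] := boolP (#|F| == 1).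
  rewrite cards1 card_gt0; apply/set0Pn; exists set0; rewrite inE.
  by apply/shatteredP => Y; rewrite subset0 => /eqP ->; exists S; rewrite ?inE ?set0I.
have [->|/set0Pn[S SF]] := eqVneq F set0; first by rewrite cards0.
move=> F1; have /card_gt0P[S' ] : 0 < #|F :\ S|.
  by move: F1; rewrite (cardsD1 S F) SF lt0n; apply: contraNneq => ->.
rewrite !inE => /andP[S'S S'F].
(* Since [S] and [S'] disagree at [x], each half misses one of them and is strictly smaller than
   [F]. *)
have [x xSS'] : exists x, (x \in S) != (x \in S').
  apply/existsP; apply: contraR S'S; rewrite negb_exists => /forallP H.
  by apply/eqP/setP => x; have /negPn/eqP := H x.
pose Fb b := [set Z in F | (x \in Z) == b].
have FbF b : Fb b \subset F by apply/subsetP => Z; rewrite inE => /andP[].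
have ltFb b : #|Fb b| < N.
  apply: leq_trans leFN; apply: proper_card; rewrite properE FbF /=.
  apply/subsetPn; have [e|ne] := eqVneq (x \in S) b.
    by exists S' => //; rewrite inE S'F /= -e eq_sym.
  by exists S => //; rewrite inE SF.
have cardF : #|F| = #|Fb true| + #|Fb false|.
  rewrite -(cardsID [set Z : {set V} | x \in Z] F); congr (_ + _).
    by apply: eq_card => Z; rewrite !inE; case: (x \in Z).
  by apply: eq_card => Z; rewrite !inE; case: (x \in Z); rewrite ?andbF ?andbT.
pose sh b := [set X | shattered (Fb b) X].
(* All members of a half agree at [x], so that half cannot shatter a set containing [x]. *)
have xsh b X : X \in sh b -> x \notin X.
  rewrite inE => /shatteredP H; apply/negP => xX.
  have [|Z ZF e1] := H X; first by [].
  have [|Z' ZF' e2] := H set0; first by rewrite sub0set.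
  have xZ : x \in Z by have := xX; rewrite -e1 inE => /andP[].
  have xZ' : x \notin Z'.
    by apply/negP => h; have /setP/(_ x) := e2; rewrite !inE xX h.
  by move: ZF ZF'; rewrite !inE xZ (negbTE xZ') => /andP[_ /eqP <-]; rewrite andbF.
rewrite cardF; apply: leq_trans (leq_add (IHN _ (ltFb true)) (IHN _ (ltFb false))) _.
rewrite -/(sh true) -/(sh false) -cardsUI.
have <- : #|[set x |: X | X in sh true :&: sh false]| = #|sh true :&: sh false|.
  rewrite card_in_imset // => X Y /setIP[/xsh nX _] /setIP[/xsh nY _] e.
  by rewrite -(setU1K nX) e setU1K.
rewrite -cardsUI [X in _ + X](_ : _ = 0) ?addn0; last first.
  apply/eqP; rewrite cards_eq0 -subset0; apply/subsetP => X.
  rewrite inE => /andP[] /setUP h /imsetP[Y _ e].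
  have xX : x \notin X by case: h => /xsh.
  by rewrite e setU11 in xX.
apply: subset_leq_card; apply/subsetP => X XU; rewrite inE.
case/setUP: XU => [|/imsetP[Y /setIP[Yt Yf] ->]].
  by case/setUP; rewrite inE; apply: shatteredS.
have nY := xsh _ _ Yt.
apply/shatteredP => Z sZ.
have sZ' : Z :\ x \subset Y by rewrite subDset.
have [S0 S0F e0] : exists2 S0, S0 \in Fb (x \in Z) & Y :&: S0 = Z :\ x.
  have shb : shattered (Fb (x \in Z)) Y.
    by move: Yt Yf; rewrite !inE; case: (x \in Z).
  by have /shatteredP/(_ _ sZ') := shb.
exists S0; first by apply: (subsetP (FbF _)) S0F.
have xS0 : (x \in S0) = (x \in Z) by move: S0F; rewrite inE => /andP[_ /eqP].
apply/setP => v; rewrite !inE; have [->|vx] := eqVneq v x; first by rewrite xS0.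
by have /setP/(_ v) := e0; rewrite !inE vx.
Qed.

(** Such a set is the range of a [K]-tuple of options, where [None] pads the tuples of sets with
    fewer than [K] elements. *)
Lemma card_small_sets (V : finType) (K : nat) :
  #|[set X : {set V} | #|X| <= K]| <= #|V|.+1 ^ K.
Proof.
pose img (f : {ffun 'I_K -> option V}) := [set v | Some v \in codom f].
have <- : #|{ffun 'I_K -> option V}| = #|V|.+1 ^ K.
  by rewrite card_ffun card_option card_ord.
rewrite -cardsT; apply: leq_trans (leq_imset_card img _).
apply: subset_leq_card; apply/subsetP => X; rewrite inE => leXK.
apply/imsetP; exists [ffun i : 'I_K => nth None (map Some (enum X)) i] => //.
apply/setP => v; rewrite inE; apply/idP/codomP => [vX|[i]].
  have lt : index v (enum X) < K.
    by apply: leq_trans leXK; rewrite cardE index_mem mem_enum.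
  exists (Ordinal lt); rewrite ffunE /= (nth_map v) ?nth_index ?index_mem ?mem_enum //.
rewrite ffunE => e; rewrite -mem_enum.
have lt : i < size (enum X).
  by rewrite ltnNge; apply/negP => h; move: e; rewrite nth_default ?size_map.
by move: e; rewrite (nth_map v) // => -[->]; rewrite mem_nth.
Qed.

Lemma sauer_shelah (V : finType) (F : {set {set V}}) (K : nat) :
  (forall X, shattered F X -> #|X| <= K) -> #|F| <= #|V|.+1 ^ K.
Proof.
move=> H; apply: leq_trans (pajor F) _; apply: leq_trans (card_small_sets V K).
by apply: subset_leq_card; apply/subsetP => X; rewrite !inE => /H.
Qed.

(** * Exponential deviation bound for random signs *)

Section Deviation.
Local Open Scope ring_scope.

Lemma bernoulli (F : realFieldType) (x : F) (n : nat) :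
  -1 <= x -> 1 + n%:R * x <= (1 + x) ^+ n.
Proof.
move=> hx; elim: n => [|n IHn]; first by rewrite mul0r addr0 expr0.
rewrite exprS; apply: le_trans (ler_wpM2l _ IHn); last lra.
have h : 0 <= n%:R :> F by []; rewrite -natr1; nra.
Qed.

(* The weight of a sign vector is a martingale-type product of mean one; it is
   large on the vectors with [\sum sg >= s]. *)
Lemma sign_deviation (n s q : nat) (u v : 'I_n -> bool) :
  (0 < q)%N -> n = (q * s)%N ->
  #|[set sg : {ffun 'I_n -> bool} |
      (\sum_i (if sg i then v i else u i) + s <=
       \sum_i (if sg i then u i else v i))%N]|%:R
    * (1 + (8 * q)%:R^-1) ^+ s <= 2 ^+ n :> rat.
Proof.
move=> q0 def_n; set bad := [set _ | _].
have qp : 1 <= q%:R :> rat by rewrite ler1n.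
(* This value gives [q * la ^+ 2 = la / 2]. By Bernoulli [(1 + la) * (1 - la ^+ 2) ^+ q] is then at
   least [(1 + la) * (1 - la / 2)], hence at least [1 + la / 4], which is the base in the
   statement. *)
pose la : rat := (2 * q)%:R^-1.
have la_q : la * q%:R * 2 = 1.
  by rewrite /la natrM; field; rewrite pnatr_eq0 -lt0n q0.
have la0 : 0 < la by rewrite invr_gt0 ltr0n muln_gt0.
have la1 : la <= 1/2 by nra.
pose w (i : 'I_n) (b : bool) : rat :=
  (1 + la * ((if b then u i else v i)%:R - (if b then v i else u i)%:R)).
have w0 i b : 0 <= w i b by rewrite /w; case: b; case: (u i); case: (v i) => /=; lra.
(* The sum over sign vectors factors over the coordinates, and the two signs of a coordinate
   contribute [(1 + la * d) + (1 - la * d) = 2]. *)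
have sumw : \sum_(sg : {ffun 'I_n -> bool}) \prod_i w i (sg i) = 2 ^+ n.
  rewrite -bigA_distr_bigA /= (eq_bigr (fun=> 2)); last first.
    by move=> i _; rewrite big_bool /w /=; lra.
  by rewrite prodr_const card_ord.
have rho : 1 + (8 * q)%:R^-1 <= (1 + la) * (1 - la ^+ 2) ^+ q.
  have := @bernoulli _ (- la ^+ 2) q; rewrite -/(1 - la ^+ 2) => /(_ _) B.
  have {}B : 1 - la / 2 <= (1 - la ^+ 2) ^+ q.
    by apply: le_trans (B _); rewrite expr2; nra.
  have -> : (8 * q)%:R^-1 = la / 4.
    by rewrite /la !natrM; field; rewrite pnatr_eq0 -lt0n q0.
  by apply: le_trans (ler_wpM2l _ B); nra.
have low sg : sg \in bad -> (1 + (8 * q)%:R^-1) ^+ s <= \prod_i w i (sg i).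
  rewrite inE; set a := (\sum_i _)%N; set b := (\sum_i _)%N => hab.
  have lean : (a <= n)%N.
    rewrite -[X in (_ <= X)%N]card_ord -sum1_card; apply: leq_sum => i _.
    by case: (sg i); case: (u i); case: (v i).
  (* Coordinatewise comparison; where [u i] and [v i] both hold, the left factor is [1 - la ^+ 2]
     and the weight is [1]. *)
  have wlow : (1 + la) ^+ b * (1 - la) ^+ a <= \prod_i w i (sg i).
    rewrite /a /b !expr_sum -big_split /=; apply: ler_prod => i _.
    rewrite /w; apply/andP; split.
      by rewrite mulr_ge0 // exprn_ge0 //; lra.
    by case: (sg i); case: (u i); case: (v i); rewrite /= ?expr0 ?expr1; nra.
  apply: le_trans wlow.
  (* Pairing [a] factors [1 + la] with the [a] factors [1 - la] leaves at least [s] factors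
     [1 + la]. The pairs give [(1 - la ^+ 2) ^+ a], and [a <= n = q * s]. *)
  have -> : b = (s + (b - (a + s)) + a)%N by lia.
  rewrite exprD -mulrA -exprMn.
  have -> : (1 + la) * (1 - la) = 1 - la ^+ 2 by ring.
  apply: (@le_trans _ _ ((1 + la) ^+ s * (1 - la ^+ 2) ^+ n)).
    rewrite def_n exprM -exprMn lerXn2r //= ?nnegrE.
      by rewrite addr_ge0 // invr_ge0.
    by rewrite mulr_ge0 ?exprn_ge0 //; [lra | nra].
  rewrite exprD; apply: ler_pM; rewrite ?exprn_ge0 //; try nra.
    rewrite ler_peMr ?exprn_ge0 //; try lra.
    by rewrite exprn_ege1 //; lra.
  by rewrite ler_wiXn2l //; nra.
(* Markov's inequality: the bad vectors alone carry at most the total weight [2 ^+ n]. *)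
rewrite -sumw mulr_natl -sumr_const.
rewrite [X in _ <= X](bigID (mem bad)) /=.
rewrite -[X in X <= _]addr0 lerD //; first by apply: ler_sum => sg /low.
by apply: sumr_ge0 => sg _; apply: prodr_ge0.
Qed.

End Deviation.

(** * Symmetrization with a second sample *)

Lemma leq_card_bigcup (T U : finType) (F : {set U}) (f : U -> {set T}) :
  #|\bigcup_(x in F) f x| <= \sum_(x in F) #|f x|.
Proof.
elim/big_rec2: _ => [|x m A _ IH]; first by rewrite cards0.
by rewrite cardsU; apply: leq_trans (leq_subr _ _) _; rewrite leq_add2l.
Qed.

Section Sampling.
Variables (T T' : finType) (r : T -> T' -> bool) (K q s : nat).
(** With this size, a gap of [s] hits is the fraction [1 / q] of a sample. *)
Let n := q * s.
Let sample := {ffun 'I_n -> T}.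
Hypothesis q_gt0 : 0 < q.
Hypothesis not_shattered : forall y : 'I_K -> T,
  ~ (forall S : {set 'I_K}, exists t, forall i, r (y i) t = (i \in S)).
Hypothesis s_large :
  ((q * (2 * n).+1 ^ K)%:R <= (1 + (8 * q)%:R^-1) ^+ s :> rat)%R.

Definition hits (g : sample) (t : T') : nat := \sum_i r (g i) t.
Definition exceeds (g g' : sample) : bool := [exists t, hits g' t + s <= hits g t].
Definition point (p : sample * sample) (v : 'I_n * bool) : T :=
  if v.2 then p.1 v.1 else p.2 v.1.
(** The two samples trade their entries at the coordinates where [sg] is false; for fixed [sg] this
    permutes the pairs of samples. *)
Definition swap (sg : {ffun 'I_n -> bool}) (p : sample * sample) : sample * sample :=
  ([ffun i => point p (i, sg i)], [ffun i => point p (i, ~~ sg i)]).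

Lemma swapK sg : involutive (swap sg).
Proof.
move=> [g g']; congr pair; apply/ffunP => i;
  by rewrite ffunE /point; case e: (sg i) => /=; rewrite ffunE /point /= e.
Qed.

(** Union bound over traces. Only the trace of [r] on the [2 * n] sampled points matters;
    Sauer-Shelah leaves at most [(2 * n).+1 ^ K] traces, [sign_deviation] bounds the bad signs of
    each, and [s_large] absorbs the number of traces together with the factor [q]. *)
Lemma swap_exceeds p :
  q * #|[set sg | exceeds (swap sg p).1 (swap sg p).2]| <= 2 ^ n.
Proof.
pose F := [set [set v | r (point p v) t] | t in T'].
pose Bad (f : {set 'I_n * bool}) := [set sg : {ffun 'I_n -> bool} |
  \sum_i (if sg i then (i, false) \in f else (i, true) \in f) + s <=
  \sum_i (if sg i then (i, true) \in f else (i, false) \in f)].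
set bad := [set _ | _].
have cardF : #|F| <= (2 * n).+1 ^ K.
  have <- : #|{: 'I_n * bool}| = 2 * n by rewrite card_prod card_ord card_bool mulnC.
  apply: sauer_shelah => X /shatteredP shX; rewrite leqNgt; apply/negP => ltKX.
  have leKX := ltnW ltKX.
  pose v (i : 'I_K) := enum_val (widen_ord leKX i).
  have v_inj : injective v by move=> i j /enum_val_inj/(congr1 val) /= /val_inj.
  apply: (not_shattered (y := fun i => point p (v i))) => S.
  have [|Z /imsetP[t _ ->] e] := shX (v @: S).
    by apply/subsetP => _ /imsetP[i _ ->]; apply: enum_valP.
  exists t => i; have /setP/(_ (v i)) := e.
  by rewrite !inE enum_valP mem_imset.
have bad_sub : bad \subset \bigcup_(f in F) Bad f.
  apply/subsetP => sg; rewrite inE => /existsP[t ht]; apply/bigcupP.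
  exists [set v | r (point p v) t]; first by apply/imsetP; exists t.
  rewrite inE; move: ht; rewrite /hits /swap /=.
  by congr (_ + _ <= _); apply: eq_bigr => i _; rewrite ffunE !inE; case: (sg i).
have cardbad : #|bad| <= \sum_(f in F) #|Bad f|.
  exact: leq_trans (subset_leq_card bad_sub) (leq_card_bigcup _ _).
rewrite -(@leq_pmul2l ((2 * n).+1 ^ K)) ?expn_gt0 // mulnA -(mulnC q).
rewrite -(@ler_nat rat) natrM mulrC.
apply: le_trans (ler_wpM2l _ s_large) _; first by [].
apply: (@le_trans _ _ (\sum_(f in F) 2 ^+ n))%R; last first.
  rewrite sumr_const -[X in (X <= _)%R]mulr_natl natrM.
  by rewrite (natrX _ 2 n); apply: ler_wpM2r; rewrite ?exprn_ge0 // ler_nat.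
apply: (@le_trans _ _ (\sum_(f in F) #|Bad f|%:R * (1 + (8 * q)%:R^-1) ^+ s))%R.
  rewrite -mulr_suml -natr_sum; apply: ler_wpM2r; last by rewrite ler_nat.
  by rewrite exprn_ge0 // addr_ge0 ?invr_ge0.
by apply: ler_sum => f _; apply: sign_deviation.
Qed.

(** Every [swap sg] is a bijection on pairs, so the sum may be averaged over all [sg]; for each
    fixed pair at most a fraction [1 / q] of the sign vectors is bad. *)
Lemma sum_exceeds : q * (\sum_g \sum_g' exceeds g g') <= #|{: sample}| * #|{: sample}|.
Proof.
rewrite pair_bigA /= -(@leq_pmul2l (2 ^ n)) ?expn_gt0 //.
have -> : 2 ^ n * (q * \sum_(p : sample * sample) exceeds p.1 p.2) =
    \sum_(p : sample * sample) q * #|[set sg | exceeds (swap sg p).1 (swap sg p).2]|.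
  rewrite mulnCA -big_distrr /=; congr (q * _).
  have step sg : \sum_(p : sample * sample) exceeds p.1 p.2 =
      \sum_(p : sample * sample) exceeds (swap sg p).1 (swap sg p).2.
    by rewrite (reindex_inj (can_inj (swapK sg))).
  transitivity (\sum_(sg : {ffun 'I_n -> bool})
      \sum_(p : sample * sample) exceeds (swap sg p).1 (swap sg p).2).
    by rewrite -(eq_bigr _ (fun sg _ => step sg)) sum_nat_const card_ffun card_bool card_ord.
  rewrite exchange_big /=; apply: eq_bigr => p _.
  by rewrite -sum1_card [RHS]big_mkcond; apply: eq_bigr => sg _; rewrite inE; case: exceeds.
apply: (@leq_trans (\sum_(p : sample * sample) 2 ^ n)).
  by apply: leq_sum => p _; apply: swap_exceeds.
by rewrite sum_nat_const card_prod mulnC.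
Qed.

(** The expected number of hits, cleared of denominators: by linearity each of the [n] uniform
    coordinates contributes the density of [r ^~ t]. *)
Lemma sum_hits t :
  #|T| * (\sum_g hits g t) = n * #|{: sample}| * #|[set y | r y t]|.
Proof.
rewrite /hits exchange_big big_distrr /= -mulnA.
rewrite -[X in X * _](card_ord n) -sum_nat_const; apply: eq_bigr => i _.
(* The indicator at coordinate [i] is written as a product over all coordinates, so that the sum
   over samples factors. *)
pose w (j : 'I_n) (y : T) : nat := if j == i then r y t : nat else 1.
have -> : \sum_(g : sample) r (g i) t = \sum_(g : sample) \prod_j w j (g j).
  apply: eq_bigr => g _; rewrite (bigD1 i) //= /w eqxx big1 ?muln1 //.
  by move=> j /negbTE ->.
rewrite -bigA_distr_bigA /= (bigD1 i) //= {1}/w eqxx.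
have -> : \sum_(y : T) r y t = #|[set y | r y t]|.
  by rewrite -sum1_card [RHS]big_mkcond; apply: eq_bigr => y _; rewrite inE; case: r.
have -> : \prod_(j < n | j != i) \sum_y w j y = \prod_(j < n | j != i) #|T|.
  apply: eq_bigr => j /negbTE ji; rewrite /w ji.
  by rewrite sum1_card.
rewrite [_ * \prod_(_ < n | _) _]mulnC mulnA; congr (_ * _).
rewrite card_ffun card_ord -[X in _ = _ ^ X](card_ord n) -prod_nat_const.
by rewrite [RHS](bigD1 i).
Qed.

Lemma hits_exceeds g g' t : hits g t <= hits g' t + s + n * exceeds g g'.
Proof.
rewrite /exceeds; case: existsP => [_|H].
  apply: leq_trans (leq_addl _ _); rewrite muln1 -[X in _ <= X]card_ord -sum1_card.
  by apply: leq_sum => i _; case: r.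
by rewrite muln0 addn0 leqNgt; apply/negP => h; apply: H; exists t; apply: ltnW.
Qed.

(** Averaging the comparison of [g] with [g'] over all [g'] replaces [hits g' t] by its mean. The
    error is [n / q] from the gap [s] plus [2 * n / q] from the exceptional [g'], which explains the
    [3]. *)
Lemma exists_sample : 0 < #|T| -> exists g : sample, forall t,
  q * (hits g t * #|T|) <= q * (n * #|[set y | r y t]|) + 3 * n * #|T| /\
  q * (n * #|[set y | r y t]|) <= q * (hits g t * #|T|) + 3 * n * #|T|.
Proof.
move=> T0; set N := #|{: sample}|.
have N0 : 0 < N by rewrite /N card_ffun expn_gt0 T0.
(* Both directions are counted together, so that a single [g] of at most average [Q] serves for the
   upper and the lower bound. *)
pose Q g := \sum_g' (exceeds g g' + exceeds g' g).
have [g leQ] : exists g, q * Q g <= 2 * N.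
  apply/existsP; apply: contraT => /existsPn H.
  have : \sum_g q * Q g <= 2 * N * N.
    rewrite -big_distrr /= /Q; under eq_bigr do rewrite big_split.
    rewrite big_split /= mulnDr [X in _ + q * X]exchange_big /=.
    by rewrite -mulnA mul2n -addnn leq_add ?sum_exceeds.
  have : \sum_(g : sample) (2 * N).+1 <= \sum_g q * Q g.
    by apply: leq_sum => g _; rewrite ltnNge.
  rewrite sum_nat_const -/N => h1 h2; have := leq_trans h1 h2; nia.
exists g => t; have hs := sum_hits t; rewrite -/N in hs.
set c := #|[set y | r y t]| in hs *; set H := \sum_g hits g t in hs.
have nE : n = q * s by [].
have h1 : N * hits g t <= H + N * s + n * Q g.
  apply: (@leq_trans (\sum_(g' : sample)
      (hits g' t + s + n * (exceeds g g' + exceeds g' g)))).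
    rewrite -sum_nat_const; apply: leq_sum => g' _.
    by apply: leq_trans (hits_exceeds g g' t) _; rewrite mulnDr; lia.
  by rewrite !big_split /= -big_distrr sum_nat_const.
have h2 : H <= N * hits g t + N * s + n * Q g.
  apply: (@leq_trans (\sum_(g' : sample)
      (hits g t + s + n * (exceeds g g' + exceeds g' g)))).
    apply: leq_sum => g' _.
    by apply: leq_trans (hits_exceeds g' g t) _; rewrite mulnDr; lia.
  by rewrite !big_split /= -big_distrr !sum_nat_const.
have e1 : q * (n * Q g) <= n * (2 * N) by rewrite mulnCA leq_mul2l leQ orbT.
have e2 : q * (N * s) = n * N by rewrite mulnCA -nE mulnC.
split; rewrite -(@leq_pmul2l N) //.
- have h1' : q * (N * hits g t) <= q * H + n * N + n * (2 * N).
    apply: leq_trans (leq_mul (leqnn q) h1) _.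
    by rewrite !mulnDr; lia.
  have := leq_mul h1' (leqnn #|T|); nia.
have h2' : q * H <= q * (N * hits g t) + n * N + n * (2 * N).
  apply: leq_trans (leq_mul (leqnn q) h2) _.
  by rewrite !mulnDr; lia.
have := leq_mul h2' (leqnn #|T|); nia.
Qed.

End Sampling.

(** By Bernoulli the exponent [8 * q * v] already gives [v + 1], so [s] gives [(v + 1) ^ K.+1]. The
    constant [c] is such that [2 * (q * s) + 1 = c * v + 1 <= c * (v + 1)], and [v = q * c ^ K]
    bounds the remaining factor. *)
Lemma exp_beats_poly (K q : nat) : 0 < q -> exists2 s, 0 < s &
  ((q * (2 * (q * s)).+1 ^ K)%:R <= (1 + (8 * q)%:R^-1) ^+ s :> rat)%R.
Proof.
move=> q0; pose c := 16 * q * q * K.+1; pose v := q * c ^ K.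
have v0 : 0 < v by rewrite muln_gt0 q0 expn_gt0 /c; nia.
exists (8 * q * v * K.+1); first by clearbody v; nia.
have le1 : (v.+1%:R <= (1 + (8 * q)%:R^-1) ^+ (8 * q * v) :> rat)%R.
  have le1 : (-1 <= (8 * q)%:R^-1 :> rat)%R by apply: (@le_trans _ _ 0%R); rewrite ?invr_ge0.
  apply: le_trans (bernoulli _ le1).
  rewrite natrM mulrAC divff ?mul1r; last by rewrite pnatr_eq0 -lt0n muln_gt0 q0.
  by rewrite nat1r.
rewrite exprM; apply: le_trans (lerXn2r K.+1 _ _ le1); rewrite ?nnegrE //; last first.
  by rewrite exprn_ge0 // addr_ge0 // invr_ge0.
rewrite -natrX ler_nat expnS.
apply: (@leq_trans (q * (c * v.+1) ^ K)).
  rewrite leq_mul2l; apply/orP; right.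
  have leX a a' : a <= a' -> a ^ K <= a' ^ K.
    by move=> le_a; case: (K) => // K'; rewrite leq_exp2r.
  by apply: leX; rewrite /c; nia.
by rewrite expnMn mulnA leq_mul2r -/v leqnSn orbT.
Qed.

(** The size [n] is fixed before [T], [T'] and [r], so one [n] serves all groups of the
    ultraproduct. The two bounds say that frequency and density differ by at most [3 / q]. *)
Lemma uniform_sampling (K q : nat) : 0 < q -> exists2 n, 0 < n &
  forall (T T' : finType) (r : T -> T' -> bool), 0 < #|T| ->
  (forall y : 'I_K -> T,
     ~ (forall S : {set 'I_K}, exists t, forall i, r (y i) t = (i \in S))) ->
  exists g : {ffun 'I_n -> T}, forall t,
  q * ((\sum_i r (g i) t) * #|T|) <= q * (n * #|[set y | r y t]|) + 3 * n * #|T| /\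
  q * (n * #|[set y | r y t]|) <= q * ((\sum_i r (g i) t) * #|T|) + 3 * n * #|T|.
Proof.
move=> q0; have [s s0 hs] := exp_beats_poly K q0.
exists (q * s); first by rewrite muln_gt0 q0.
by move=> T T' r T0 hr; apply: (exists_sample q0 hr hs T0).
Qed.

End UniformLaw.

(** * Substitution and derived connectives for the two-sorted language *)

Section Substitution.
Variable L : lang.

Fixpoint tsubst (sg : nat -> term L) (t : term L) : term L :=
  match t with
  | tvar i => sg i
  | tapp f ts => tapp (fun k => tsubst sg (ts k))
  end.

Definition tshift : term L -> term L := tsubst (fun i => tvar L i.+1).

Fixpoint fsubst (sg : nat -> term L) (p : form L) : form L :=
  match p with
  | feq t u => feq (tsubst sg t) (tsubst sg u)
  | Defs.frel r ts => Defs.frel (fun k => tsubst sg (ts k))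
  | fneg q => fneg (fsubst sg q)
  | fand q1 q2 => fand (fsubst sg q1) (fsubst sg q2)
  | fex q => fex (fsubst (scons (tvar L 0) (fun i => tshift (sg i))) q)
  end.

Fixpoint embed (p : form L) : pform L :=
  match p with
  | feq t u => peq t u
  | Defs.frel r ts => prel ts
  | fneg q => pneg (embed q)
  | fand q1 q2 => pand (embed q1) (embed q2)
  | fex q => pexH (embed q)
  end.

Variables (M I : Type) (P : pstruc L M I).
Implicit Types (e : nat -> M) (eI : nat -> I).
Let S := hstr P.

Lemma teval_tsubst sg e t :
  teval S e (tsubst sg t) = teval S (fun i => teval S e (sg i)) t.
Proof.
elim: t => //= f ts IH; congr (fint _ _ _).
by apply: functional_extensionality => k.
Qed.

Lemma sat_fsubst sg e p :
  sat S e (fsubst sg p) = sat S (fun i => teval S e (sg i)) p.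
Proof.
elim: p sg e => /= [t u|r ts|q IH|q1 IH1 q2 IH2|q IH] sg e.
- by rewrite !teval_tsubst.
- by congr (rint _ _ _); apply: functional_extensionality => k; rewrite teval_tsubst.
- by rewrite IH.
- by rewrite IH1 IH2.
congr (ex _); apply: functional_extensionality => a; rewrite IH.
congr (sat _ _ _); apply: functional_extensionality => -[|i] //=.
by rewrite teval_tsubst.
Qed.

Lemma psat_embed e eI p : psat P e eI (embed p) = sat S e p.
Proof.
elim: p e => //= [q IH|q1 IH1 q2 IH2|q IH] e; rewrite ?IH ?IH1 ?IH2 //.
by congr (ex _); apply: functional_extensionality => a; rewrite IH.
Qed.

Definition pallH (p : pform L) := pneg (pexH (pneg p)).
Definition pallI (p : pform L) := pneg (pexI (pneg p)).
Definition pimp (p q : pform L) := pneg (pand p (pneg q)).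
Definition ptrue : pform L := peq (tvar L 0) (tvar L 0).
Definition pands (ps : list (pform L)) := foldr (@pand L) ptrue ps.
Definition pbigand (T : finType) (p : T -> pform L) := pands (map p (enum T)).
Definition pexs n (p : pform L) := iter n (@pexH L) p.
Definition palls n (p : pform L) := pneg (pexs n (pneg p)).

Lemma psat_pallH e eI p :
  psat P e eI (pallH p) = (forall a, psat P (scons a e) eI p).
Proof.
apply: propositional_extensionality; split=> /= H; last by case=> a; apply.
by move=> a; apply: NNPP => h; apply: H; exists a.
Qed.

Lemma psat_pallI e eI p :
  psat P e eI (pallI p) = (forall a, psat P e (scons a eI) p).
Proof.
apply: propositional_extensionality; split=> /= H; last by case=> a; apply.
by move=> a; apply: NNPP => h; apply: H; exists a.
Qed.

Lemma psat_pimp e eI p q :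
  psat P e eI (pimp p q) = (psat P e eI p -> psat P e eI q).
Proof.
apply: propositional_extensionality; split=> /= H; last by case=> /H.
by move=> a; apply: NNPP => h; apply: H.
Qed.

Lemma psat_pbigand e eI (T : finType) (p : T -> pform L) :
  psat P e eI (pbigand p) = (forall i, psat P e eI (p i)).
Proof.
apply: propositional_extensionality.
have -> : (forall i, psat P e eI (p i)) <-> (forall i, i \in enum T -> psat P e eI (p i)).
  by split=> H i; [move=> _; apply: H | apply: H; rewrite mem_enum].
rewrite /pbigand; elim: (enum T) => //= x s ->; split=> [[H0 H] i|H].
  by rewrite inE => /predU1P[->|/H].
by split=> [|i si]; apply: H; rewrite inE ?eqxx ?si ?orbT.
Qed.

Definition cat_env n (a : 'I_n -> M) e : nat -> M :=
  fun i => if insub i is Some k then a k else e (i - n).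

Lemma cat_envl n a e (i : 'I_n) : cat_env a e i = a i.
Proof. by rewrite /cat_env valK. Qed.

Lemma cat_envr n (a : 'I_n -> M) e i : cat_env a e (n + i) = e i.
Proof. by rewrite /cat_env insubF ?ltnNge ?leq_addr // addKn. Qed.

(** In the inductive step the outermost quantifier is pushed up by the inner ones and ends at index
    [n], so its value is the last entry of the tuple. *)
Lemma psat_pexs e eI n p :
  psat P e eI (pexs n p) = (exists a : 'I_n -> M, psat P (cat_env a e) eI p).
Proof.
apply: propositional_extensionality; elim: n e => [|n IHn] e /=.
  have ce (a : 'I_0 -> M) : cat_env a e = e.
    by apply: functional_extensionality => i; rewrite -[i in LHS]add0n cat_envr.
  by split=> [H|[a]]; [exists (@ord0_elim M); rewrite ce | rewrite ce].
have ce a (f : 'I_n -> M) (g : 'I_n.+1 -> M) :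
  (forall i : 'I_n, g (widen_ord (leqnSn n) i) = f i) -> g ord_max = a ->
    cat_env g e = cat_env f (scons a e).
  move=> gf ga; apply: functional_extensionality => i.
  have [lt|le] := ltnP i n.
    by rewrite -[i]/(nat_of_ord (Ordinal lt)) cat_envl -gf -(cat_envl g e).
  rewrite -(subnKC le) cat_envr; case: (i - n) => [|j] /=.
    by rewrite addn0 -ga -(cat_envl g e).
  by rewrite addnS -addSn cat_envr.
split=> [[a]|[g H]].
  rewrite IHn => -[f H].
  pose g (i : 'I_n.+1) := if insub (nat_of_ord i) is Some k then f k else a.
  exists g; rewrite (@ce a f) // => [i|]; first by rewrite /g /= valK.
  by rewrite /g insubF //= ltnn.
exists (g ord_max); rewrite IHn; exists (fun i => g (widen_ord (leqnSn n) i)).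
by rewrite -(@ce _ _ g).
Qed.

Lemma psat_palls e eI n p :
  psat P e eI (palls n p) = (forall a : 'I_n -> M, psat P (cat_env a e) eI p).
Proof.
rewrite /palls /= psat_pexs; apply: propositional_extensionality.
split=> H; last by case=> a /=; apply.
by move=> a; apply: NNPP => h; apply: H; exists a.
Qed.

End Substitution.

(** * The theorem of Łoś and transfer to the elementary extension *)

Section Los.
Variables (L : lang) (J : Type) (U : (J -> Prop) -> Prop).
Hypothesis UU : ultrafilter U.

Lemma ultra_true X : (forall j, X j) -> U X.
Proof. by case: UU => UT [_ [Usub _]] H; apply: Usub UT _ => j _; apply: H. Qed.

Lemma ultra_sub (X Y : J -> Prop) : U X -> (forall j, X j -> Y j) -> U Y.
Proof. by case: UU => _ [_ [Usub _]]; apply: Usub. Qed.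

Lemma ultra_sub2 (X Y Z : J -> Prop) :
  U X -> U Y -> (forall j, X j -> Y j -> Z j) -> U Z.
Proof.
case: UU => _ [_ [Usub [UI _]]] UX UY H; apply: Usub (UI _ _ UX UY) _ => j [].
exact: H.
Qed.

Lemma ultra_iff (X Y Z : J -> Prop) :
  U Z -> (forall j, Z j -> (X j <-> Y j)) -> (U X <-> U Y).
Proof. by move=> UZ H; split=> h; apply: ultra_sub2 UZ h _ => j /H[]. Qed.

Lemma ultra_not X : U (fun j => ~ X j) <-> ~ U X.
Proof.
case: UU => _ [U0 [_ [_ Udec]]]; split=> [h1 h2|h].
  by apply: U0; apply: ultra_sub2 h1 h2 _ => j.
by case: (Udec X).
Qed.

Lemma ultra_and X Y : U (fun j => X j /\ Y j) <-> U X /\ U Y.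
Proof.
split=> [h|[h1 h2]]; last by apply: ultra_sub2 h1 h2 _ => j.
by split; apply: ultra_sub h _ => j [].
Qed.

Lemma ultra_all (T : finType) (X : T -> J -> Prop) :
  (forall i, U (X i)) -> U (fun j => forall i, X i j).
Proof.
move=> H; have : U (fun j => forall i, i \in enum T -> X i j).
  elim: (enum T) => [|x s IHs]; first exact: ultra_true.
  by apply: ultra_sub2 (H x) IHs _ => j h1 h2 i; rewrite inE => /predU1P[->|/h2].
by move/ultra_sub; apply=> j h i; apply: h; rewrite mem_enum.
Qed.

Lemma ucls_eq (T : J -> Type) (a a' : forall j, T j) :
  U (fun j => a j = a' j) -> ucls U a = ucls U a'.
Proof.
move=> h; rewrite /ucls.
have e : eqU U a = eqU U a'.
  apply: functional_extensionality => c; apply: propositional_extensionality.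
  by apply: ultra_iff h _ => j ->.
move: (ex_intro _ a _) (ex_intro _ a' _); rewrite e => p p'.
by rewrite (proof_irrelevance _ p p').
Qed.

Lemma urepK (T : J -> Type) (x : uprod U T) : ucls U (urep x) = x.
Proof.
case: x => C pC; rewrite /urep; case: constructive_indefinite_description => a /= e.
by subst C; rewrite /ucls; congr (exist _ _ _); apply: proof_irrelevance.
Qed.

Lemma urep_ucls (T : J -> Type) (a : forall j, T j) :
  U (fun j => urep (ucls U a) j = a j).
Proof.
rewrite /urep; case: constructive_indefinite_description => c /= e.
have : eqU U a a by apply: ultra_true.
by rewrite e => h; apply: ultra_sub h _ => j.
Qed.

Lemma ucls_inj (T : J -> Type) (a a' : forall j, T j) :
  ucls U a = ucls U a' <-> U (fun j => a j = a' j).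
Proof.
split=> [e|]; last exact: ucls_eq.
have := urep_ucls a; rewrite e => h.
by apply: ultra_sub2 h (urep_ucls a') _ => j <- <-.
Qed.

Variables (A : J -> finType) (SA : forall j, lstruc L (A j)) (a0 : forall j, A j).
Let P := upstruc U SA.

Definition at_ (T : J -> Type) (e : nat -> uprod U T) (j : J) : nat -> T j :=
  fun i => urep (e i) j.

Lemma teval_ultra (e : nat -> UH U A) t :
  U (fun j => urep (teval (hstr P) e t) j = teval (SA j) (at_ e j) t).
Proof.
elim: t => [i|f ts IH] /=; first exact: ultra_true.
apply: ultra_sub2 (urep_ucls (fun j => fint (SA j) f
  (fun k => urep (teval (hstr P) e (ts k)) j))) (ultra_all IH) _ => j -> h.
by congr (fint _ _ _); apply: functional_extensionality.
Qed.

Lemma ieval_ultra (e : nat -> UH U A) (eI : nat -> UI U) s :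
  U (fun j => urep (ieval P e eI s) j =
              ieval (finexp (SA j)) (at_ e j) (at_ eI j) s).
Proof.
elim: s => [i|s1 IH1 s2 IH2|n m q ts]; first exact: ultra_true.
  apply: ultra_sub2 (urep_ucls (fun j => idist (finexp (SA j))
    (urep (ieval P e eI s1) j) (urep (ieval P e eI s2) j)))
    (proj2 (ultra_and _ _) (conj IH1 IH2)) _ => j -> [h1 h2].
  by rewrite h1 h2.
apply: ultra_sub2 (urep_ucls (fun j => imuI (finexp (SA j)) n q
  (fun k => urep (teval (hstr P) e (ts k)) j)))
  (ultra_all (fun k => teval_ultra e (ts k))) _ => j -> h.
by congr (imuI _ _ _ _); apply: functional_extensionality.
Qed.

Lemma at_scons (T : J -> Type) (a : uprod U T) e j :
  at_ (scons a e) j = scons (urep a j) (at_ e j).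
Proof. by apply: functional_extensionality => -[|i]. Qed.

(** Induction on the formula: negation uses that [U] is an ultrafilter, and the quantifiers use a
    choice of witnesses in each coordinate. *)
Theorem los p (e : nat -> UH U A) (eI : nat -> UI U) :
  psat P e eI p <-> U (fun j => psat (finexp (SA j)) (at_ e j) (at_ eI j) p).
Proof.
elim: p e eI => [t u|r ts|s1 s2|s1 s2|q IH|q1 IH1 q2 IH2|q IH|q IH] e eI.
- rewrite /= -(urepK (teval _ e t)) -(urepK (teval _ e u)) ucls_inj.
  apply: ultra_iff (proj2 (ultra_and _ _) (conj (teval_ultra e t) (teval_ultra e u))) _.
  by move=> j [-> ->].
- apply: ultra_iff (ultra_all (fun k => teval_ultra e (ts k))) _ => j h /=.
  by rewrite (functional_extensionality _ _ h).
- rewrite /= -(urepK (ieval _ e eI s1)) -(urepK (ieval _ e eI s2)) ucls_inj.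
  apply: ultra_iff (proj2 (ultra_and _ _) (conj (ieval_ultra e eI s1) (ieval_ultra e eI s2))) _.
  by move=> j [-> ->].
- apply: ultra_iff (proj2 (ultra_and _ _) (conj (ieval_ultra e eI s1) (ieval_ultra e eI s2))) _.
  by move=> j [-> ->].
- by rewrite /= ultra_not IH.
- by rewrite /= ultra_and IH1 IH2.
- split=> /= [[a /IH h]|].
    by apply: ultra_sub h _ => j; rewrite at_scons; exists (urep a j).
  (* A witness wherever one exists, which is the case for [U]-almost all [j]; elsewhere the value is
     arbitrary, and [a0] ensures that there is one. *)
  pose a j := epsilon (inhabits (a0 j))
    (fun x => psat (finexp (SA j)) (scons x (at_ e j)) (at_ eI j) q).
  move=> h; exists (ucls U a); apply/IH.
  apply: ultra_sub2 h (urep_ucls a) _ => j hj ea.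
  by rewrite at_scons ea /a; apply: (epsilon_spec _ _ hj).
split=> /= [[a /IH h]|].
  by apply: ultra_sub h _ => j; rewrite at_scons; exists (urep a j).
pose a j := epsilon (inhabits zeroI)
  (fun x => psat (finexp (SA j)) (at_ e j) (scons x (at_ eI j)) q).
move=> h; exists (ucls U a); apply/IH.
apply: ultra_sub2 h (urep_ucls a) _ => j hj ea.
by rewrite at_scons ea /a; apply: (epsilon_spec _ _ hj).
Qed.

Variables (M I : Type) (G : pstruc L M I) (hH : UH U A -> M) (hI : UI U -> I).
Hypothesis elemG : elem_emb P G hH hI.

(** The copy in [G] of a standard real: the image of the class of a constant sequence. *)
Definition constI (r : unitI) : I := hI (ucls U (fun _ : J => r)).

(** The chosen representative of a constant class equals that constant only [U]-almost everywhere,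
    so only finitely many parameters, the first [N], can be controlled at once. The home environment
    is left open, since the formulas used do not depend on it. *)
Theorem transfer p (N : nat) (eI : nat -> unitI) :
  (forall j e eI', (forall i, i < N -> eI' i = eI i) ->
     psat (finexp (SA j)) e eI' p) ->
  exists e, psat G e (fun i => constI (eI i)) p.
Proof.
move=> H; exists (fun i => hH (ucls U a0)).
apply/(elemG p (fun=> ucls U a0) (fun i => ucls U (fun _ => eI i)))/los.
have h := ultra_all (fun i : 'I_N => urep_ucls (fun _ : J => eI i)).
apply: ultra_sub h _ => j hj; apply: H => i lt_i.
exact: (hj (Ordinal lt_i)).
Qed.
End Los.

Lemma asbP (Q : Prop) : reflect Q (asb Q).
Proof. by rewrite /asb; case: excluded_middle_informative => h; constructor. Qed.

Lemma pred_ext (M : Type) (X Y : M -> Prop) : (forall a, X a <-> Y a) -> X = Y.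
Proof.
by move=> h; apply: functional_extensionality => a; apply: propositional_extensionality.
Qed.

(** * Integration of counting functions against a finitely additive measure *)

Section Integration.
Variables (M : Type) (B : (M -> Prop) -> Prop) (nu : (M -> Prop) -> R).
Hypotheses (BB : boolean_algebra B) (nuP : fin_add_prob B nu).
Local Open Scope R_scope.

Lemma algebra_not X : B X -> B (fun a => ~ X a).
Proof. by case: BB => _ [h _]; apply: h. Qed.

Lemma algebra_and X Y : B X -> B Y -> B (fun a => X a /\ Y a).
Proof.
case: BB => _ [_ BU] BX BY.
have -> : (fun a => X a /\ Y a) = (fun a => ~ (~ X a \/ ~ Y a)).
  by apply: pred_ext => a; split; [tauto | move/not_or_and => [/NNPP ? /NNPP ?]].
by apply/algebra_not/BU; apply: algebra_not.
Qed.

Lemma prob_split X Y : B X -> B Y ->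
  nu Y = nu (fun a => Y a /\ X a) + nu (fun a => Y a /\ ~ X a).
Proof.
case: nuP => _ [_ add] BX BY; rewrite -add; last by move=> a; tauto.
- by congr nu; apply: pred_ext => a; tauto.
- exact: algebra_and.
- exact: algebra_and (algebra_not BX).
Qed.

Lemma prob_empty : nu (fun _ => False) = 0.
Proof.
case: nuP => _ [_ add]; case: (BB) => /algebra_not BF _.
have {}BF : B (fun _ => False).
  by move: BF; congr B; apply: pred_ext => a; tauto.
have := add _ _ BF BF (fun _ h _ => h).
have -> : (fun _ : M => False \/ False) = (fun _ => False).
  by apply: pred_ext => a; tauto.
lra.
Qed.

Lemma prob_unit X : B X -> 0 <= nu X <= 1.
Proof.
move=> BX; case: nuP => nuT [nu0 _]; split; first exact: nu0.
case: (BB) => BT _; have := prob_split BX BT; rewrite nuT => ->.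
have -> : (fun a => True /\ X a) = X by apply: pred_ext => a; tauto.
by have := nu0 _ (algebra_and BT (algebra_not BX)); lra.
Qed.

Variables (T : Type) (Y : T -> M -> Prop).
Hypothesis BY : forall i, B (Y i).

(** This is the integral over [D] of the function counting the [i] in [l] with [Y i a]. *)
Definition sum_prob (l : seq T) (D : M -> Prop) : R :=
  foldr (fun i s => nu (fun a => D a /\ Y i a) + s) 0 l.

Lemma sum_prob_split l D X : B D -> B X -> sum_prob l D =
  sum_prob l (fun a => D a /\ X a) + sum_prob l (fun a => D a /\ ~ X a).
Proof.
move=> BD BX; elim: l => [|i l IH] /=; first lra.
rewrite IH (prob_split BX (algebra_and BD (BY i))).
have -> : (fun a => (D a /\ Y i a) /\ X a) = (fun a => (D a /\ X a) /\ Y i a).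
  by apply: pred_ext => a; tauto.
have -> : (fun a => (D a /\ Y i a) /\ ~ X a) = (fun a => (D a /\ ~ X a) /\ Y i a).
  by apply: pred_ext => a; tauto.
lra.
Qed.

(* The factor [c] is [1] or [-1], giving the upper and the lower bound. *)
Lemma sum_prob_le (c : R) l D h : B D ->
  (forall a, D a -> c * INR (count (fun i => asb (Y i a)) l) <= h) ->
  c * sum_prob l D <= h * nu D.
Proof.
elim: l D h => [|i l IH] D h BD /= H.
  have nuD : 0 <= nu D by case: nuP => _ [h0 _]; apply: h0.
  have [[a Da]|nD] := classic (exists a, D a); first by have := H _ Da; nra.
  have -> : D = (fun _ => False).
    by apply: pred_ext => a; split=> // Da; apply: nD; exists a.
  by rewrite prob_empty; lra.
(* [D] is cut along [Y i]: inside, [i] itself accounts for one hit, so the rest of the list is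
   bounded by [h - c]; outside, the bound stays [h]. *)
have h1 := IH (fun a => D a /\ Y i a) (h - c) (algebra_and BD (BY i)).
have h2 := IH (fun a => D a /\ ~ Y i a) h (algebra_and BD (algebra_not (BY i))).
rewrite (sum_prob_split l BD (BY i)) (prob_split (BY i) BD).
have {}h1 := h1 _; have {}h2 := h2 _.
have {}h1 : c * sum_prob l (fun a => D a /\ Y i a) <= (h - c) * nu (fun a => D a /\ Y i a).
  apply: h1 => a [Da Yia]; have := H _ Da.
  case: asbP => // _; rewrite plus_INR /=; lra.
have {}h2 : c * sum_prob l (fun a => D a /\ ~ Y i a) <= h * nu (fun a => D a /\ ~ Y i a).
  by apply: h2 => a [Da Yia]; have := H _ Da; case: asbP.
lra.
Qed.

(** Bounds on the counting function are integrated over the whole space, where its integral is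
    [INR (size l) * v]. *)
Lemma average_bound (v lo hi : R) (l : seq T) : (forall i, nu (Y i) = v) ->
  (forall a, lo <= INR (count (fun i => asb (Y i a)) l) <= hi) ->
  lo <= INR (size l) * v <= hi.
Proof.
move=> nuY H; case: (BB) => BT _; case: (nuP) => nuT _.
have -> : INR (size l) * v = sum_prob l (fun _ => True).
  elim: l {H} => [|i l IH]; first by rewrite /=; lra.
  rewrite -[size (i :: l)]/(size l).+1 S_INR [sum_prob _ _]/= -IH.
  have -> : (fun a => True /\ Y i a) = Y i by apply: pred_ext => a; tauto.
  rewrite (nuY i); lra.
have h1 := @sum_prob_le 1 l (fun _ => True) hi BT.
have h2 := @sum_prob_le (-1) l (fun _ => True) (- lo) BT.
rewrite nuT in h1 h2; split.
  by have := h2 (fun a _ => _); move/(_ ltac:(move=> a; have := H a; lra)); lra.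
by have := h1 (fun a _ => _); move/(_ ltac:(move=> a; have := H a; lra)); lra.
Qed.

End Integration.

(** * Group identities from the left-handed axioms, and left translates *)

Section GroupFacts.
Variables (L : lang) (M : Type) (S : lstruc L M).
Hypothesis grpS : is_group S.

Lemma group_mulA a b c : s_mul S (s_mul S a b) c = s_mul S a (s_mul S b c).
Proof. by case: grpS. Qed.
Lemma group_mul1 a : s_mul S (s_one S) a = a.
Proof. by case: grpS => _ []. Qed.
Lemma group_mulV a : s_mul S (s_inv S a) a = s_one S.
Proof. by case: grpS => _ []. Qed.

Lemma group_mulKV a x : s_mul S (s_inv S a) (s_mul S a x) = x.
Proof. by rewrite -group_mulA group_mulV group_mul1. Qed.

Lemma group_mulgV a : s_mul S a (s_inv S a) = s_one S.
Proof.
rewrite -[LHS]group_mul1 -{1}(group_mulV (s_inv S a)) group_mulA.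
by rewrite (group_mulKV a) group_mulV.
Qed.

Lemma group_mulVK a x : s_mul S a (s_mul S (s_inv S a) x) = x.
Proof. by rewrite -group_mulA group_mulgV group_mul1. Qed.

Lemma group_mulg1 a : s_mul S a (s_one S) = a.
Proof. by rewrite -(group_mulV a) -group_mulA group_mulgV group_mul1. Qed.

Lemma group_mulKg a x : s_mul S (s_mul S x a) (s_inv S a) = x.
Proof. by rewrite group_mulA group_mulgV group_mulg1. Qed.

Lemma group_mulVKg a x : s_mul S (s_mul S x (s_inv S a)) a = x.
Proof. by rewrite group_mulA group_mulV group_mulg1. Qed.

Lemma ltransE g (X : M -> Prop) :
  ltrans S g X = (fun a => X (s_mul S (s_inv S g) a)).
Proof.
apply: pred_ext => a; split=> [[x [Xx ->]]|Xa]; first by rewrite group_mulKV.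
by exists (s_mul S (s_inv S g) a); rewrite group_mulVK.
Qed.

Lemma ltrans1 (X : M -> Prop) : ltrans S (s_one S) X = X.
Proof.
rewrite ltransE; apply: pred_ext => a.
suff -> : s_inv S (s_one S) = s_one S by rewrite group_mul1.
by rewrite -[LHS]group_mulg1 group_mulV.
Qed.

End GroupFacts.

(** * The sampling statement as a first-order formula *)

Section Formulas.
Variable L : lang.

Definition tmul (t u : term L) : term L :=
  @tapp L (gmul L) (fun i => if nat_of_ord i == 0 then t else u).
Definition tinv (t : term L) : term L := @tapp L (ginv L) (fun _ => t).
Definition tone : term L :=
  @tapp L (gone L) (fun i => ord0_elim (term L) (cast_ord (gone_ar L) i)).
Definition piff (c : bool) (p : pform L) : pform L := if c then p else pneg p.

Definition phi_at (phi : form L) m (t : term L) (bs : 'I_m -> term L) : pform L :=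
  embed (fsubst (mkenv tone (fun _ : 'I_1 => t) bs) phi).

(* Variables: [x] is variable 0, [y_i] is variable [i.+1], and the parameters
   [b_j] follow the [y_i]. *)
Definition trace_form (phi : form L) m n (Z : {set 'I_n}) : pform L :=
  pbigand (fun i : 'I_n => piff (i \in Z)
    (phi_at phi (tmul (tvar L i.+1) (tvar L 0)) (fun j : 'I_m => tvar L (n + j).+1))).

(* In the sort I, variable 0 stands for the error bound and variable [s.+1] for
   the fraction [s / n]. *)
Definition sampling_form (phi : form L) m K n : pform L :=
  palls m (pimp
    (pneg (pexs K (pbigand (fun Z : {set 'I_K} => pexH (trace_form phi m Z)))))
    (pexs n (pallH (pbigand (fun Z : {set 'I_n} => pimp (trace_form phi m Z)
       (plt (idst (imu 1 phi (fun j : 'I_m => tvar L (n + j).+1)) (ivar L #|Z|.+1))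
            (ivar L 0))))))).

Section Meaning.
Variables (M I : Type) (P : pstruc L M I).
Let S := hstr P.

Definition instance (phi : form L) m (b : 'I_m -> M) (a : M) : Prop :=
  sat S (mkenv (s_one S) (fun _ : 'I_1 => a) b) phi.

Lemma psat_pneg e eI p : psat P e eI (pneg p) = ~ psat P e eI p.
Proof. by []. Qed.

Lemma psat_pand e eI p q :
  psat P e eI (pand p q) = (psat P e eI p /\ psat P e eI q).
Proof. by []. Qed.

Lemma teval_tmul e t u : teval S e (tmul t u) = s_mul S (teval S e t) (teval S e u).
Proof.
rewrite /s_mul /=; congr (fint _ _ _); apply: functional_extensionality => k.
by case: eqP.
Qed.

Lemma teval_tone e : teval S e tone = s_one S.
Proof.
rewrite /s_one /=; congr (fint _ _ _); apply: functional_extensionality => k.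
by case: (cast_ord (gone_ar L) k).
Qed.

Lemma psat_piff e eI c p : psat P e eI (piff c p) <-> (psat P e eI p <-> c).
Proof.
case: c; split=> [h|[h1 h2]] //; first exact: h2.
by move=> /h1.
Qed.

Lemma psat_phi_at phi m t (bs : 'I_m -> term L) e eI :
  psat P e eI (phi_at phi t bs) =
  instance phi (fun j => teval S e (bs j)) (teval S e t).
Proof.
rewrite psat_embed sat_fsubst /instance; congr (sat _ _ _).
apply: functional_extensionality => i; rewrite /mkenv.
by case: insub => //; case: insub => //; rewrite teval_tone.
Qed.

Lemma psat_trace_form phi m n (Z : {set 'I_n}) x y (b : 'I_m -> M) e eI :
  psat P (scons x (cat_env y (cat_env b e))) eI (trace_form phi m Z) <->
  (forall i, instance phi b (s_mul S (y i) x) <-> i \in Z).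
Proof.
rewrite psat_pbigand.
have E i : psat P (scons x (cat_env y (cat_env b e))) eI
    (phi_at phi (tmul (tvar L i.+1) (tvar L 0)) (fun j : 'I_m => tvar L (n + j).+1)) =
    instance phi b (s_mul S (cat_env y (cat_env b e) i) x).
  rewrite psat_phi_at teval_tmul /=; congr (instance _ _ _).
  by apply: functional_extensionality => j; rewrite cat_envr cat_envl.
by split=> H i; move: (H i); rewrite psat_piff E cat_envl.
Qed.

(** The bound on shattering is a premise about [b] inside the statement, which therefore holds in
    every finite group; it is discharged only in [G], where NIP is available. The second sort has no
    division, so the frequencies enter through parameters [frac]. *)
Definition samples_well (phi : form L) m K n (eps : I) (frac : nat -> I) : Prop :=
  forall b : 'I_m -> M,
  ~ (exists y : 'I_K -> M, forall Z : {set 'I_K}, exists x, forall i,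
       instance phi b (s_mul S (y i) x) <-> i \in Z) ->
  exists g : 'I_n -> M, forall x (Z : {set 'I_n}),
    (forall i, instance phi b (s_mul S (g i) x) <-> i \in Z) ->
    ilt P (idist P (imuI P 1 phi b) (frac #|Z|)) eps.

Lemma psat_sampling_form phi m K n e eI :
  psat P e eI (sampling_form phi m K n) <->
  samples_well phi m K n (eI 0) (fun s => eI s.+1).
Proof.
have mu_b (b : 'I_m -> M) (g : 'I_n -> M) :
    (fun j : 'I_m => cat_env g (cat_env b e) (n + j)) = b.
  by apply: functional_extensionality => j; rewrite cat_envr cat_envl.
rewrite /sampling_form psat_palls /samples_well.
split=> H b; move: (H b) => {H}.
  rewrite psat_pimp => H nK.
  have nS : psat P (cat_env b e) eI (pneg (pexs K
      (pbigand (fun Z : {set 'I_K} => pexH (trace_form phi m Z))))).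
    rewrite psat_pneg psat_pexs => -[y]; rewrite psat_pbigand => Hy; apply: nK.
    by exists y => Z; have [x /psat_trace_form Hx] := Hy Z; exists x.
  have := H nS; rewrite psat_pexs => -[g Hg]; exists g => x Z Hx.
  move: Hg; rewrite psat_pallH => /(_ x); rewrite psat_pbigand => /(_ Z).
  rewrite psat_pimp => /(_ (proj2 (psat_trace_form _ _ _ _ _ _ _) Hx)) /=.
  by rewrite mu_b.
move=> H; rewrite psat_pimp psat_pneg psat_pexs => nK.
have [|g Hg] := H.
  move=> [y Hy]; apply: nK; exists y; rewrite psat_pbigand => Z.
  by have [x Hx] := Hy Z; exists x; apply/psat_trace_form.
rewrite psat_pexs; exists g; rewrite psat_pallH => x; rewrite psat_pbigand => Z.
rewrite psat_pimp => /psat_trace_form/Hg /=.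
by rewrite mu_b.
Qed.

End Meaning.
End Formulas.

(** * Arithmetic in the unit interval *)

Section UnitInterval.
Local Open Scope R_scope.

Lemma mkIK r : 0 <= r <= 1 -> proj1_sig (mkI r) = r.
Proof. by move=> h; rewrite /= /clamp Rmin_right ?Rmax_right; lra. Qed.

Lemma unit_dist (s t : unitI) :
  proj1_sig (mkI (Rabs (proj1_sig s - proj1_sig t))) =
  Rabs (proj1_sig s - proj1_sig t).
Proof.
apply: mkIK; case: s t => [s hs] [t ht] /=; split; first exact: Rabs_pos.
by apply: Rabs_le; lra.
Qed.

Lemma frac_unit (a b : nat) : (a <= b)%nat -> (0 < b)%nat -> 0 <= INR a / INR b <= 1.
Proof.
move=> /leP/le_INR ab /ltP/lt_0_INR b0; have a0 := pos_INR a.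
have bi := Rinv_0_lt_compat _ b0; rewrite /Rdiv; split; first nra.
apply: (Rmult_le_reg_r (INR b)) => //; rewrite Rmult_assoc Rinv_l; lra.
Qed.

(** Both counting bounds are divided by [q * n * a]. *)
Lemma frac_close (q n a z c : nat) : (0 < q)%nat -> (0 < n)%nat -> (0 < a)%nat ->
  (q * (z * a) <= q * (n * c) + 3 * n * a)%nat ->
  (q * (n * c) <= q * (z * a) + 3 * n * a)%nat ->
  Rabs (INR c / INR a - INR z / INR n) <= 3 / INR q.
Proof.
move=> /ltP/lt_0_INR q0 /ltP/lt_0_INR n0 /ltP/lt_0_INR a0 /leP/le_INR h1 /leP/le_INR h2.
move: h1 h2; rewrite !plus_INR !mult_INR.
have -> : INR 3 = 3 by rewrite /=; lra.
have ec : INR c = INR c / INR a * INR a by field; lra.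
have ez : INR z = INR z / INR n * INR n by field; lra.
have eq : 3 / INR q * INR q = 3 by field; lra.
move: (INR c / _) (INR z / _) (3 / _) ec ez eq => u v w -> -> eq h1 h2.
have na : 0 < INR n * INR a by nra.
have {}h1 : INR q * v <= INR q * u + 3.
  by apply: (Rmult_le_reg_l _ _ _ na); lra.
have {}h2 : INR q * u <= INR q * v + 3.
  by apply: (Rmult_le_reg_l _ _ _ na); lra.
apply: Rabs_le; split; apply: (Rmult_le_reg_l _ _ _ q0); lra.
Qed.

End UnitInterval.

(** * The sampling statement in finite groups *)

Section FiniteGroups.
Variables (L : lang) (A : finType) (S : lstruc L A).
Hypothesis grpS : is_group S.

(** Right multiplication by [x] is a bijection of [A], so all fibres of the relation [phi (y * x)]
    have the same density, namely [mu_phi]. *)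
Lemma count_translate phi m (b : 'I_m -> A) x :
  count_sol S 1 phi b = #|[set y | asb (instance (finexp S) phi b (s_mul S y x))]|.
Proof.
pose h (y : A) : {ffun 'I_1 -> A} := [ffun=> s_mul S y x].
have h_inj : injective h.
  move=> y y' /ffunP/(_ ord0); rewrite !ffunE => e.
  by rewrite -(group_mulKg grpS x y) e group_mulKg.
rewrite -(card_imset _ h_inj); apply: eq_card => f; rewrite inE.
have hE y : asb (sat S (mkenv (s_one S) (h y) b) phi) =
    asb (instance (finexp S) phi b (s_mul S y x)).
  rewrite /instance; congr (asb (sat _ (mkenv _ _ _) _)).
  by apply: functional_extensionality => i; rewrite ffunE.
apply/idP/imsetP => [Hf|[y Hy ->]]; last by rewrite hE; rewrite inE in Hy.
have ef : f = h (s_mul S (f ord0) (s_inv S x)).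
  by apply/ffunP => i; rewrite ffunE group_mulVKg // ord1.
by exists (s_mul S (f ord0) (s_inv S x)) => //; rewrite inE -hE -ef.
Qed.

Lemma finite_samples_well phi m K q n eps (frac : nat -> unitI) : 0 < q -> 0 < n ->
  (forall (T T' : finType) (r : T -> T' -> bool), 0 < #|T| ->
   (forall y : 'I_K -> T,
      ~ (forall Z : {set 'I_K}, exists t, forall i, r (y i) t = (i \in Z))) ->
   exists g : {ffun 'I_n -> T}, forall t,
   q * ((\sum_i r (g i) t) * #|T|) <= q * (n * #|[set y | r y t]|) + 3 * n * #|T| /\
   q * (n * #|[set y | r y t]|) <= q * ((\sum_i r (g i) t) * #|T|) + 3 * n * #|T|) ->
  (3 / INR q < proj1_sig eps)%R ->
  (forall s, s <= n -> frac s = mkI (INR s / INR n)) ->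
  samples_well (finexp S) phi m K n eps frac.
Proof.
move=> q0 n0 unif q_eps fracE b nK.
pose r y x := asb (instance (finexp S) phi b (s_mul S y x)).
have A0 : 0 < #|A| by apply/card_gt0P; exists (s_one S).
have [|g Hg] := unif A A r A0.
  move=> y Hy; apply: nK; exists y => Z; have [x Hx] := Hy Z; exists x => i.
  by rewrite -Hx; split=> /asbP.
exists g => x Z HZ; have [h1 h2] := Hg x.
have rZ i : r (g i) x = (i \in Z) by apply/asbP/idP => /HZ.
have sZ : \sum_i r (g i) x = #|Z|.
  by rewrite -sum1_card [RHS]big_mkcond; apply: eq_bigr => i _; rewrite rZ; case: ifP.
have leZ : #|Z| <= n by rewrite -[n in _ <= n]card_ord max_card.
move: h1 h2; rewrite sZ -count_translate => h1 h2.
have leA : count_sol S 1 phi b <= #|A| by rewrite (count_translate _ _ x) max_card.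
change (proj1_sig (mkI (Rabs (
  proj1_sig (mkI (INR (count_sol S 1 phi b) / INR (Nat.pow #|A| 1))) -
  proj1_sig (frac #|Z|)))) < proj1_sig eps)%R.
rewrite unit_dist fracE // PeanoNat.Nat.pow_1_r !mkIK; try exact: frac_unit.
exact: Rle_lt_trans (frac_close q0 n0 A0 h1 h2) q_eps.
Qed.
End FiniteGroups.

(** * Duality for NIP and passage to the nonstandard group *)

Lemma dual_nip (M : Type) (psi : M -> M -> Prop) : NIP psi ->
  exists K : nat, ~ exists y : 'I_K -> M, forall Z : {set 'I_K}, exists x,
    forall i, psi x (y i) <-> i \in Z.
Proof.
(* The [y] are indexed by the subsets of ['I_k]. If they are shattered, some point cuts out the
   subsets containing [i], for each [i]; these [k] points are shattered by the [y], against NIP. *)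
case=> k nk; exists #|{set 'I_k}| => -[y Hy]; apply: nk.
pose Z (i : 'I_k) := [set l : 'I_#|{set 'I_k}| | i \in enum_val l].
have Ha i := constructive_indefinite_description _ (Hy (Z i)).
exists (fun i => proj1_sig (Ha i)), (fun X => y (enum_rank X)) => i X.
by rewrite (proj2_sig (Ha i)) inE enum_rankK.
Qed.

Section Nonstandard.
Variables (L : lang) (J : Type) (U : (J -> Prop) -> Prop).
Variables (A : J -> finType) (SA : forall j, lstruc L (A j)).
Variables (M I : Type) (G : pstruc L M I) (hH : UH U A -> M) (hI : UI U -> I).
Hypotheses (UU : ultrafilter U) (grpA : forall j, is_group (SA j)).
Hypothesis elemG : elem_emb (upstruc U SA) G hH hI.
Let S := hstr G.

Definition near (t : I) (r e : unitI) : Prop :=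
  ilt G (idist G t (constI hI r)) (constI hI e).

Let transferG := transfer UU (fun j => s_one (SA j)) elemG.

Lemma elem_group : is_group S.
Proof.
pose x := tvar L; split; last split.
- pose p := pallH (pallH (pallH (peq (tmul (tmul (x 2) (x 1)) (x 0))
                                     (tmul (x 2) (tmul (x 1) (x 0)))))).
  have [|e] := @transferG p 0 (fun=> zeroI).
    move=> j e eI' _; rewrite /p !psat_pallH => a; rewrite psat_pallH => b.
    by rewrite psat_pallH => c; rewrite /psat !teval_tmul /=; case: (grpA j).
  rewrite /p psat_pallH => H a b c; move: (H a); rewrite psat_pallH => /(_ b).
  by rewrite psat_pallH => /(_ c); rewrite /psat !teval_tmul.
- pose p := pallH (peq (tmul (tone L) (x 0)) (x 0)).
  have [|e] := @transferG p 0 (fun=> zeroI).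
    move=> j e eI' _; rewrite /p psat_pallH => a; rewrite /psat teval_tmul teval_tone.
    by case: (grpA j) => _ [h _]; apply: h.
  by rewrite /p psat_pallH => H a; move: (H a); rewrite /psat teval_tmul teval_tone.
pose p := pallH (peq (tmul (tinv (x 0)) (x 0)) (tone L)).
have [|e] := @transferG p 0 (fun=> zeroI).
  move=> j e eI' _; rewrite /p psat_pallH => a; rewrite /psat teval_tmul teval_tone.
  by case: (grpA j) => _ [_ h]; apply: h.
by rewrite /p psat_pallH => H a; move: (H a); rewrite /psat teval_tmul teval_tone.
Qed.

Let close (i j : nat) : pform L := plt (idst (ivar L 0) (ivar L i)) (ivar L j).

Local Lemma psat_close j e (eI : nat -> unitI) i k :
  psat (finexp (SA j)) e eI (close i k) =
  (Rabs (proj1_sig (eI 0%nat) - proj1_sig (eI i)) < proj1_sig (eI k))%R.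
Proof.
change (psat (finexp (SA j)) e eI (close i k)) with (proj1_sig
  (mkI (Rabs (proj1_sig (eI 0%nat) - proj1_sig (eI i)))) < proj1_sig (eI k))%R.
by rewrite unit_dist.
Qed.

Local Lemma env4 (r1 r2 e1 e2 : unitI) (eI' : nat -> unitI) :
  (forall i, (i < 4)%nat -> eI' i = nth zeroI [:: r1; r2; e1; e2] i) ->
  [/\ eI' 0 = r1, eI' 1 = r2, eI' 2 = e1 & eI' 3 = e2].
Proof. by move=> h; rewrite !h. Qed.

(** If the standard reals were too far apart, no point of any finite structure could be close to
    both, by the triangle inequality in the reals; this universal statement transfers to [G] and
    excludes [t]. *)
Lemma near_triangle t r1 r2 e1 e2 : near t r1 e1 -> near t r2 e2 ->
  (Rabs (proj1_sig r1 - proj1_sig r2) < proj1_sig e1 + proj1_sig e2)%R.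
Proof.
move=> h1 h2; case: (Rlt_or_le (Rabs (proj1_sig r1 - proj1_sig r2))
  (proj1_sig e1 + proj1_sig e2)) => // far; exfalso.
(* The quantifier makes [t] variable 0, so the parameters [r1], [r2], [e1], [e2] become variables 1
   to 4. *)
have [|e] := @transferG (pallI (pneg (pand (close 1 3) (close 2 4)))) 4
               (nth zeroI [:: r1; r2; e1; e2]).
  move=> j e eI' /env4[E0 E1 E2 E3]; rewrite psat_pallI => s.
  rewrite psat_pneg psat_pand !psat_close [scons _ _ _]/=.
  rewrite [scons _ _ 1]/= [scons _ _ 2]/= [scons _ _ 3]/= [scons _ _ 4]/= E0 E1 E2 E3 => -[a b].
  have := Rabs_triang (proj1_sig r1 - proj1_sig s) (proj1_sig s - proj1_sig r2).
  rewrite Rabs_minus_sym in a; have -> : forall u v w : R, (u - v + (v - w) = u - w)%R by move=> *; lra.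
  lra.
rewrite psat_pallI => /(_ t); apply; split; [exact: h1 | exact: h2].
Qed.

Lemma near_weaken t r1 r2 e1 e2 : near t r1 e1 ->
  (Rabs (proj1_sig r1 - proj1_sig r2) + proj1_sig e1 <= proj1_sig e2)%R ->
  near t r2 e2.
Proof.
move=> h1 h2.
have [|e] := @transferG (pallI (pimp (close 1 3) (close 2 4))) 4
               (nth zeroI [:: r1; r2; e1; e2]).
  move=> j e eI' /env4[E0 E1 E2 E3]; rewrite psat_pallI => s; rewrite psat_pimp.
  rewrite !psat_close.
  rewrite [scons _ _ 0]/= [scons _ _ 1]/= [scons _ _ 2]/= [scons _ _ 3]/= [scons _ _ 4]/= E0 E1 E2 E3 => a.
  have := Rabs_triang (proj1_sig s - proj1_sig r1) (proj1_sig r1 - proj1_sig r2).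
  have -> : forall u v w : R, (u - v + (v - w) = u - w)%R by move=> *; lra.
  lra.
by rewrite psat_pallI => /(_ t); rewrite psat_pimp; apply.
Qed.

(** The sampling formula holds in all finite groups with one [n], hence in [G], where dual NIP
    provides its premise. *)
Lemma nip_approximation phi m (b : 'I_m -> M) (eps : unitI) :
  NIP (fun x y => instance G phi b (s_mul S y x)) -> (0 < proj1_sig eps)%R ->
  exists n (g : 'I_n -> M), 0 < n /\ forall x,
    near (imuI G 1 phi b)
      (mkI (INR #|[set i | asb (instance G phi b (s_mul S (g i) x))]| / INR n)) eps.
Proof.
move=> /dual_nip[K nK] eps0.
have [q q0 q_eps] : exists2 q, 0 < q & (3 / INR q < proj1_sig eps)%R.
  have [q0 [h1 h2]] := archimed_cor1 (proj1_sig eps / 3) ltac:(lra).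
  by exists q0; [apply/ltP | rewrite /Rdiv; lra].
have [n n0 unif] := UniformLaw.uniform_sampling K q0.
(* The parameters are [eps] and the fractions [s / n] for [s] from 0 to [n], which makes [n.+2] of
   them. *)
pose eI i := if i is s.+1 then mkI (INR s / INR n) else eps.
have [|e /psat_sampling_form H] := @transferG (sampling_form phi m K n) n.+2 eI.
  move=> j e eI' E; apply/psat_sampling_form.
  apply: (finite_samples_well (grpA j) q0 n0 unif); first by rewrite E.
  by move=> s les; rewrite E.
have [|g Hg] := H b; first by case=> y Hy; apply: nK; exists y.
exists n, g; split=> // x; apply: Hg => i.
rewrite inE; exact: (rwP (asbP _)).
Qed.

Lemma near_invariant phi m (b : 'I_m -> M) B nu (eps : unitI) :
  NIP (fun x y => instance G phi b (s_mul S y x)) ->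
  boolean_algebra B -> fin_add_prob B nu -> left_invariant S B nu ->
  (forall g, B (ltrans S g (instance G phi b))) ->
  (0 < proj1_sig eps)%R ->
  near (imuI G 1 phi b) (mkI (nu (instance G phi b))) eps.
Proof.
move=> nip BB nuP inv Btr eps0; set phiG := instance G phi b in Btr *.
have grpG := elem_group.
have BphiG : B phiG by rewrite -(ltrans1 grpG phiG).
have eps1 : (proj1_sig eps <= 1)%R by case: (eps) => ? /= [].
(* One third of [eps]: all frequencies lie within [2 * d] of the frequency at the identity, hence so
   does [nu phiG] by integration, and [mu_phi] lies within [d] of that frequency. *)
pose d := mkI (proj1_sig eps / 3).
have dE : proj1_sig d = (proj1_sig eps / 3)%R by apply: mkIK; lra.
have [n [g [n0 Hg]]] := nip_approximation (eps := d) nip ltac:(lra).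
pose c x := #|[set i | asb (phiG (s_mul S (g i) x))]|.
have c_le x : (c x <= n)%N by rewrite -[n in _ <= n]card_ord max_card.
have nr : (0 < INR n)%R by apply/lt_0_INR/ltP.
pose v x := (INR (c x) / INR n)%R.
have v_unit x : (0 <= v x <= 1)%R by apply: frac_unit.
have Hv x : near (imuI G 1 phi b) (mkI (v x)) d by apply: Hg.
have close_v x : (Rabs (v x - v (s_one S)) < 2 * proj1_sig d)%R.
  by have := near_triangle (Hv x) (Hv (s_one S)); rewrite (mkIK (v_unit x)) (mkIK (v_unit _)); lra.
(* The sets being averaged are left translates of [phiG], so they belong to [B] and share its
   measure. *)
have transE i : (fun a => phiG (s_mul S (g i) a)) = ltrans S (s_inv S (g i)) phiG.
  rewrite (ltransE grpG); apply: pred_ext => a.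
  suff -> : s_inv S (s_inv S (g i)) = g i by [].
  by rewrite -[LHS](group_mulg1 grpG) -(group_mulV grpG (g i)) group_mulKV.
have nuY i : nu (fun a => phiG (s_mul S (g i) a)) = nu phiG.
  by rewrite transE inv.
have BY i : B (fun a => phiG (s_mul S (g i) a)) by rewrite transE.
have countE x : count (fun i => asb (phiG (s_mul S (g i) x))) (enum 'I_n) = c x.
  by rewrite /c cardsE cardE -size_filter enumT.
have cE x : INR (c x) = (v x * INR n)%R by rewrite /v; field; lra.
have := average_bound BB nuP BY (lo := ((v (s_one S) - 2 * proj1_sig d) * INR n)%R)
  (hi := ((v (s_one S) + 2 * proj1_sig d) * INR n)%R) (l := enum 'I_n) nuY.
rewrite size_enum_ord => bound.
have {bound}[x | lo hi] := bound _.
  rewrite countE cE; have /Rabs_def2[h1 h2] := close_v x; nra.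
have nu_unit := prob_unit BB nuP BphiG.
apply: (near_weaken (Hv (s_one S))); rewrite (mkIK (v_unit _)) (mkIK nu_unit).
rewrite dE in lo hi *.
have {}lo : (v (s_one S) - 2 * (proj1_sig eps / 3) <= nu phiG)%R.
  by apply: (Rmult_le_reg_l _ _ _ nr); lra.
have {}hi : (nu phiG <= v (s_one S) + 2 * (proj1_sig eps / 3))%R.
  by apply: (Rmult_le_reg_l _ _ _ nr); lra.
by apply: (Rle_trans _ (2 * (proj1_sig eps / 3) + proj1_sig eps / 3));
  [apply: Rplus_le_compat_r; apply: Rabs_le; lra | lra].
Qed.

(** [stdpart] is a choice among standard parts, so its value is determined once standard parts are
    shown to be unique. *)
Lemma stdpartE t r : is_stdpart G (constI hI) t r ->
  stdpart G (constI hI) t = proj1_sig r.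
Proof.
move=> hr; rewrite /stdpart.
have := epsilon_spec (inhabits zeroI) (is_stdpart G (constI hI) t) (ex_intro _ r hr).
set r' := epsilon _ _ => hr'; apply: NNPP => ne.
(* Half the distance of the two candidates, cut off at 1 to stay in the interval; [near_triangle]
   with this radius makes the distance smaller than itself. *)
pose d := mkI (Rmin 1 (Rabs (proj1_sig r' - proj1_sig r) / 2)).
have pos := Rabs_pos_lt _ (Rminus_eq_contra _ _ ne).
have dE : proj1_sig d = Rmin 1 (Rabs (proj1_sig r' - proj1_sig r) / 2).
  by apply: mkIK; split; [apply: Rmin_glb; lra | apply: Rmin_l].
have d0 : (0 < proj1_sig d)%R by rewrite dE; apply: Rmin_glb_lt; lra.
have := near_triangle (hr' _ d0) (hr _ d0); rewrite dE.
have := Rmin_r 1 (Rabs (proj1_sig r' - proj1_sig r) / 2); lra.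
Qed.

End Nonstandard.

Theorem theorem5p9 (L : lang) (J : Type) (U : (J -> Prop) -> Prop)
  (A : J -> finType) (SA : forall j, lstruc L (A j))
  (M I : Type) (G : pstruc L M I)
  (hH : UH U A -> M) (hI : UI U -> I)
  (phi : form L) (m : nat) (b : 'I_m -> M)
  (B : (M -> Prop) -> Prop) (nu : (M -> Prop) -> R) :
  ultrafilter U ->
  (forall j, is_group (SA j)) ->
  elem_emb (upstruc U SA) G hH hI ->
  aleph1_saturated G ->
  let phiG : M -> Prop :=
    fun a => sat (hstr G) (mkenv (s_one (hstr G)) (fun _ : 'I_1 => a) b) phi in
  NIP (fun x y => phiG (s_mul (hstr G) y x)) ->
  boolean_algebra B ->
  fin_add_prob B nu ->
  left_invariant (hstr G) B nu ->
  (forall g, B (ltrans (hstr G) g phiG)) ->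
  nu phiG = stdpart G (fun r => hI (ucls U (fun _ : J => r))) (imuI G 1 phi b).
Proof.
move=> UU grpA elemG _ phiG nip BB nuP inv Btr.
have BphiG : B phiG by rewrite -(ltrans1 (elem_group UU grpA elemG) phiG).
have st : is_stdpart G (constI hI) (imuI G 1 phi b) (mkI (nu phiG)).
  by move=> eps eps0; apply: (near_invariant UU grpA elemG nip BB nuP inv Btr).
by rewrite (stdpartE UU elemG st) mkIK //; apply: prob_unit BphiG.
Qed.
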